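(* Let $L$ be a simple Lie algebra over a field $k\neq\mathbb F_2$, generated by its pure extremal elements, and assume that the extremal geometry of $L$ contains lines. Let $x,y\in E$ with $g(x,y)=1$ and let $L=L_{-2}\oplus L_{-1}\oplus L_0\oplus L_1\oplus L_2$ be the associated $5$-grading. Then both $L_{-1}$ and $L_1$ are linearly spanned by the extremal elements contained in them.
   Context: A nonzero $x\in L$ is extremal if there is $g_x\colon L\to k$ with $[x,[x,u]]=2g_x(u)x$, $[[x,u],[x,w]]=g_x([u,w])x+g_x(w)[x,u]-g_x(u)[x,w]$, $[x,[u,[x,w]]]=g_x([u,w])x-g_x(w)[x,u]-g_x(u)[x,w]$ for all $u,w\in L$; a sandwich satisfies $[x,[x,u]]=0=[x,[u,[x,w]]]$ for all $u,w$; a pure extremal element is an extremal non-sandwich; $E$ is the set of extremal elements. $g$ is the unique symmetric bilinear form with $g(x,u)=g_x(u)$ for $x\in E$ (it satisfies $g([a,b],c)=g(a,[b,c])$). Pure extremal $a,b$ with $ka\neq kb$ are collinear if $[a,b]=0$ and $\lambda a+\mu b\in E\cup\{0\}$ for all $\lambda,\mu$; the extremal geometry contains lines iff such a pair exists. The $5$-grading associated with $x,y$ ($g(x,y)=1$): $L_{-2}=kx$, $L_{-1}=[x,U]$, $L_0=\{l:[x,l]\in kx,\ [y,l]\in ky\}$, $L_1=[y,U]$, $L_2=ky$, where $U=\{u:g(u,x)=g(u,y)=g(u,[x,y])=0\}$. *)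

(* Defs.v *)
From HB Require Import structures.
From mathcomp Require Import all_boot all_order all_algebra.
Set Implicit Arguments. Unset Strict Implicit. Unset Printing Implicit Defensive.
Import GRing.Theory.
Local Open Scope ring_scope.

Section LieDefs.
Variables (k : fieldType) (L : lmodType k) (br : L -> L -> L).

Definition is_lie_bracket : Prop :=
  (forall (a : k) (u v w : L), br (a *: u + v) w = a *: br u w + br v w) /\
  (forall (a : k) (u v w : L), br w (a *: u + v) = a *: br w u + br w v) /\
  (forall u : L, br u u = 0) /\
  (forall u v w : L, br u (br v w) + br v (br w u) + br w (br u v) = 0).

Definition extremal_form (x : L) (f : L -> k) : Prop :=
  forall u w : L,
    br x (br x u) = (f u *+ 2) *: x /\
    br (br x u) (br x w) = f (br u w) *: x + f w *: br x u - f u *: br x w /\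
    br x (br u (br x w)) = f (br u w) *: x - f w *: br x u - f u *: br x w.

Definition extremal (x : L) : Prop :=
  x <> 0 /\ exists f : L -> k, extremal_form x f.

Definition sandwich (x : L) : Prop :=
  forall u w : L, br x (br x u) = 0 /\ br x (br u (br x w)) = 0.

Definition pure_extremal (x : L) : Prop := extremal x /\ ~ sandwich x.

Definition distinct_lines (a b : L) : Prop :=
  ~ (forall v : L, (exists c : k, v = c *: a) <-> (exists c : k, v = c *: b)).

Definition collinear (a b : L) : Prop :=
  pure_extremal a /\ pure_extremal b /\ distinct_lines a b /\ br a b = 0 /\
  forall l m : k, extremal (l *: a + m *: b) \/ l *: a + m *: b = 0.

Definition geometry_has_lines : Prop := exists a b : L, collinear a b.

Definition is_extremal_bilinear_form (g : L -> L -> k) : Prop :=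
  (forall (a : k) (u v w : L), g (a *: u + v) w = a * g u w + g v w) /\
  (forall u v : L, g u v = g v u) /\
  (forall x : L, extremal x -> extremal_form x (g x)).

Definition lie_ideal (I : L -> Prop) : Prop :=
  I 0 /\ (forall u v, I u -> I v -> I (u + v)) /\
  (forall (a : k) u, I u -> I (a *: u)) /\
  (forall u v, I v -> I (br u v)).

Definition simple_lie : Prop :=
  (exists u v : L, br u v <> 0) /\
  forall I : L -> Prop, lie_ideal I -> (forall v, I v -> v = 0) \/ (forall v, I v).

Definition generated_by_pure_extremal : Prop :=
  forall S : L -> Prop,
    S 0 -> (forall u v, S u -> S v -> S (u + v)) ->
    (forall (a : k) u, S u -> S (a *: u)) ->
    (forall u v, S u -> S v -> S (br u v)) ->
    (forall p, pure_extremal p -> S p) ->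
    forall v, S v.

Definition grading_U (g : L -> L -> k) (x y u : L) : Prop :=
  g u x = 0 /\ g u y = 0 /\ g u (br x y) = 0.

Definition L_minus1 (g : L -> L -> k) (x y v : L) : Prop :=
  exists u, grading_U g x y u /\ v = br x u.
Definition L_plus1 (g : L -> L -> k) (x y v : L) : Prop :=
  exists u, grading_U g x y u /\ v = br y u.

Definition in_span (P : L -> Prop) (v : L) : Prop :=
  exists (n : nat) (c : 'I_n -> k) (e : 'I_n -> L),
    (forall i, P (e i)) /\ v = \sum_(i < n) c i *: e i.

End LieDefs.

(* Main.v *)
(* For an extremal [z], the maps exp(z, s) u = u + s [z, u] + s^2 g(z, u) z are
   automorphisms preserving [g]; since the extremal identities are quadratic, a
   line with three extremal points is extremal, and this lets one extract graded
   components: if [e] is extremal with g(y, e) = 0, then its component in L_{-1}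
   is extremal or zero.

   A collinear pair yields a strongly commuting pair: p, b with
   [b, [p, u]] = g(b, u) p + g(p, u) b. The elements having such a partner span
   an ideal, and one not orthogonal to x can be reflected onto a multiple of x,
   so x has such a partner; hence L_{-1} contains an extremal b, and even
   extremal b in L_{-1}, c in L_1 with [b, [c, x]] = kappa x, kappa <> 0.

   Let Q be the span of the extremal elements of L_{-1}. For e extremal with
   component a in L_{-1}, choose t such that exp(b, t) exp(c, s) e is orthogonal
   to y; its component in L_{-1} then lies in Q, and comparing two values of s
   gives [b, [c, a]] = kappa a modulo Q. The pair ([x, c], [y, b]) has the same
   properties, but [[x, c], [[y, b], a]] = kappa a - [b, [c, a]] modulo Q by the
   Jacobi identity. Hence kappa a lies in Q, and these components a
   span L_{-1} because the extremal elements span L. *)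
Require Import Defs.
From HB Require Import structures.
From Stdlib Require Import Classical_Prop.
From mathcomp Require Import all_boot all_order all_algebra ring.
Set Implicit Arguments. Unset Strict Implicit. Unset Printing Implicit Defensive.
Import GRing.Theory.
Local Open Scope ring_scope.

(** * Deciding linear identities in a module by reflection *)

Section LinearReflection.
Variables (k : nzRingType) (L : lmodType k).

Inductive lin :=
  LAtom of nat | LZero | LAdd of lin & lin | LOpp of lin | LScale of k & lin.

Fixpoint leval (env : seq L) e : L := match e with
  | LAtom i => nth 0 env i
  | LZero => 0
  | LAdd a b => leval env a + leval env b
  | LOpp a => - leval env a
  | LScale c a => c *: leval env a
  end.

Fixpoint lcoef e (i : nat) : k := match e with
  | LAtom j => if eqn i j then 1 else 0
  | LZero => 0
  | LAdd a b => lcoef a i + lcoef b i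
  | LOpp a => - lcoef a i
  | LScale c a => c * lcoef a i
  end.

Lemma levalE env e : leval env e = \sum_(i < size env) lcoef e i *: nth 0 env i.
Proof.
elim: e => [j||a IHa b IHb|a IHa|c a IHa] /=.
- have [lt_j|le_j] := ltnP j (size env).
    rewrite (bigD1 (Ordinal lt_j)) //= big1 => [|i neq_i].
      by rewrite -[eqn j j]/(j == j) eqxx scale1r addr0.
    rewrite -[eqn i j]/(val i == val (Ordinal lt_j)) val_eqE (negbTE neq_i).
    exact: scale0r.
  rewrite nth_default // big1 // => i _.
  rewrite -[eqn i j]/(val i == j) ltn_eqF ?scale0r //.
  exact: leq_trans (ltn_ord i) le_j.
- by rewrite big1 // => i _; rewrite scale0r.
- by rewrite IHa IHb -big_split; apply: eq_bigr => i _; rewrite scalerDl.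
- by rewrite IHa -sumrN; apply: eq_bigr => i _; rewrite scaleNr.
- by rewrite IHa scaler_sumr; apply: eq_bigr => i _; rewrite scalerA.
Qed.

(** A recursive conjunction, so that [cbn] unfolds it into one scalar equation per atom. *)
Fixpoint same_coef n e1 e2 : Prop :=
  if n is m.+1 then lcoef e1 m = lcoef e2 m /\ same_coef m e1 e2 else True.

Lemma leval_eq env e1 e2 :
  same_coef (size env) e1 e2 -> leval env e1 = leval env e2.
Proof.
move=> eq12; rewrite !levalE; apply: eq_bigr => i _; congr (_ *: _).
move: (nat_of_ord i) (ltn_ord i) => j.
elim: (size env) eq12 => //= n IHn [eq_n eq_lt]; rewrite ltnS leq_eqVlt.
by case/predU1P => [->//|]; apply: IHn.
Qed.

End LinearReflection.

Ltac lmem x s := lazymatch s with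
  | nil => constr:(false)
  | x :: _ => constr:(true)
  | _ :: ?s' => lmem x s'
  end.
Ltac lindex x s := lazymatch s with
  | x :: _ => constr:(O)
  | _ :: ?s' => let n := lindex x s' in constr:(S n)
  end.
Ltac latoms s t := lazymatch t with
  | @GRing.add _ ?a ?b => let s' := latoms s a in latoms s' b
  | @GRing.opp _ ?a => latoms s a
  | @GRing.scale _ _ _ ?a => latoms s a
  | @GRing.zero _ => s
  | _ => lazymatch lmem t s with true => s | false => constr:(t :: s) end
  end.
Ltac lreify k s t := lazymatch t with
  | @GRing.add _ ?a ?b =>
      let a' := lreify k s a in let b' := lreify k s b in constr:(LAdd a' b')
  | @GRing.opp _ ?a => let a' := lreify k s a in constr:(LOpp a')
  | @GRing.scale _ _ ?c ?a => let a' := lreify k s a in constr:(@LScale k c a')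
  | @GRing.zero _ => constr:(@LZero k)
  | _ => let n := lindex t s in constr:(@LAtom k n)
  end.
(* Reduces an equality in an [lmodType k] to equalities of coefficients. *)
Ltac lmod k := lazymatch goal with
  | |- @eq ?T ?a ?b =>
    let s := latoms (@nil T) a in let s := latoms s b in
    let a' := lreify k s a in let b' := lreify k s b in
    refine (@leval_eq k _ s a' b' _);
    cbn [size same_coef lcoef eqn]; repeat split; try ring
  end.

(** * Submodules and linear spans *)

Section Span.
Variables (k : fieldType) (L : lmodType k).

Definition submod (Q : L -> Prop) : Prop :=
  Q 0 /\ (forall u v, Q u -> Q v -> Q (u + v)) /\ (forall (a : k) u, Q u -> Q (a *: u)).

Lemma submodB Q u v : submod Q -> Q u -> Q v -> Q (u - v).
Proof. by move=> [_ [QD QZ]] Qu Qv; rewrite -scaleN1r; apply/QD/QZ. Qed.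

Lemma submod_unscale Q (c : k) u : submod Q -> c != 0 -> Q (c *: u) -> Q u.
Proof.
by move=> [_ [_ QZ]] c0 /(QZ c^-1); rewrite scalerA mulVf // scale1r.
Qed.

(** Serves as an induction principle: a linear property of the generators passes to the span. *)
Lemma in_span_sub (P Q : L -> Prop) v :
  submod Q -> (forall u, P u -> Q u) -> in_span P v -> Q v.
Proof.
move=> [Q0 [QD QZ]] PQ [n [c [e [Pe ->]]]].
by apply: big_ind => // i _; apply/QZ/PQ/Pe.
Qed.

Lemma in_span_gen (P : L -> Prop) v : P v -> in_span P v.
Proof.
move=> Pv; exists 1%N, (fun=> 1), (fun=> v); split=> //.
by rewrite big_ord1 scale1r.
Qed.

Lemma in_span_submod (P : L -> Prop) : submod (in_span P).
Proof.
split; [|split].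
- by exists 0%N, (fun=> 0), (fun=> 0); split=> [[]//|]; rewrite big_ord0.
- move=> _ _ [m [c [e [Pe ->]]]] [n [d [f [Pf ->]]]].
  exists (m + n)%N, (fun i => match split i with inl j => c j | inr j => d j end),
    (fun i => match split i with inl j => e j | inr j => f j end); split.
    by move=> i; case: (split i).
  rewrite big_split_ord; congr (_ + _); apply: eq_bigr => i _.
    by rewrite (unsplitK (inl i)).
  by rewrite (unsplitK (inr i)).
- move=> a _ [m [c [e [Pe ->]]]]; exists m, (fun i => a * c i), e; split=> //.
  by rewrite scaler_sumr; apply: eq_bigr => i _; rewrite scalerA.
Qed.

End Span.

(** * Calculus of the bracket, the form and the extremal identities *)

Section ExtremalLie.
Variables (k : fieldType) (L : lmodType k) (br : L -> L -> L) (g : L -> L -> k).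
Hypothesis brP : is_lie_bracket br.
Hypothesis gP : is_extremal_bilinear_form br g.

Local Notation "⟦ u , v ⟧" := (br u v) (at level 0, format "⟦ u ,  v ⟧").

Lemma brDl u v w : ⟦u + v, w⟧ = ⟦u, w⟧ + ⟦v, w⟧.
Proof. by have [/(_ 1 u v w)] := brP; rewrite !scale1r. Qed.
Lemma brDr u v w : ⟦w, u + v⟧ = ⟦w, u⟧ + ⟦w, v⟧.
Proof. by have [_ [/(_ 1 u v w)]] := brP; rewrite !scale1r. Qed.
Lemma br0l w : ⟦0, w⟧ = 0.
Proof. by apply: (addrI ⟦0, w⟧); rewrite -brDl !addr0. Qed.
Lemma br0r w : ⟦w, 0⟧ = 0.
Proof. by apply: (addrI ⟦w, 0⟧); rewrite -brDr !addr0. Qed.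
Lemma brZl a u w : ⟦a *: u, w⟧ = a *: ⟦u, w⟧.
Proof. by have [/(_ a u 0 w)] := brP; rewrite br0l !addr0. Qed.
Lemma brZr a u w : ⟦w, a *: u⟧ = a *: ⟦w, u⟧.
Proof. by have [_ [/(_ a u 0 w)]] := brP; rewrite br0r !addr0. Qed.
Lemma brNl u w : ⟦- u, w⟧ = - ⟦u, w⟧.
Proof. by rewrite -!scaleN1r brZl. Qed.
Lemma brNr u w : ⟦w, - u⟧ = - ⟦w, u⟧.
Proof. by rewrite -!scaleN1r brZr. Qed.
Lemma brxx u : ⟦u, u⟧ = 0.
Proof. by have [_ [_ []]] := brP. Qed.
Definition brE := (brDl, brDr, brZl, brZr, brNl, brNr, br0l, br0r, brxx).

Lemma brC u v : ⟦u, v⟧ = - ⟦v, u⟧.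
Proof.
apply/eqP; rewrite -addr_eq0; apply/eqP.
by have := brxx (u + v); rewrite !brE add0r addr0 addrC.
Qed.

Lemma brA u v w : ⟦u, ⟦v, w⟧⟧ = ⟦⟦u, v⟧, w⟧ + ⟦v, ⟦u, w⟧⟧.
Proof.
have [_ [_ [_ /(_ u v w)]]] := brP.
rewrite (brC w ⟦u, v⟧) (brC w u) brNr => /eqP.
by rewrite subr_eq0 subr_eq => /eqP.
Qed.

Lemma gDl u v w : g (u + v) w = g u w + g v w.
Proof. by have [/(_ 1 u v w)] := gP; rewrite scale1r mul1r. Qed.
Lemma gC u v : g u v = g v u.
Proof. by have [_ []] := gP. Qed.
Lemma gDr u v w : g w (u + v) = g w u + g w v.
Proof. by rewrite !(gC w) gDl. Qed.
Lemma g0l w : g 0 w = 0.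
Proof. by apply: (addrI (g 0 w)); rewrite -gDl !addr0. Qed.
Lemma gZl a u w : g (a *: u) w = a * g u w.
Proof. by have [/(_ a u 0 w)] := gP; rewrite g0l !addr0. Qed.
Lemma g0r w : g w 0 = 0. Proof. by rewrite gC g0l. Qed.
Lemma gZr a u w : g w (a *: u) = a * g w u.
Proof. by rewrite !(gC w) gZl. Qed.
Lemma gNl u w : g (- u) w = - g u w.
Proof. by rewrite -!scaleN1r gZl mulN1r. Qed.
Lemma gNr u w : g w (- u) = - g w u.
Proof. by rewrite -!scaleN1r gZr mulN1r. Qed.
Definition gE := (gDl, gDr, gZl, gZr, gNl, gNr, g0l, g0r).

(* Extremal or zero, see [extremalE]. *)
Definition ext (v : L) : Prop := extremal_form br v (g v).

Lemma ext1 x u : ext x -> ⟦x, ⟦x, u⟧⟧ = (g x u *+ 2) *: x.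
Proof. by case/(_ u 0). Qed.
Lemma ext2 x u w : ext x ->
  ⟦⟦x, u⟧, ⟦x, w⟧⟧ = g x ⟦u, w⟧ *: x + g x w *: ⟦x, u⟧ - g x u *: ⟦x, w⟧.
Proof. by case/(_ u w) => _ []. Qed.
Lemma ext3 x u w : ext x ->
  ⟦x, ⟦u, ⟦x, w⟧⟧⟧ = g x ⟦u, w⟧ *: x - g x w *: ⟦x, u⟧ - g x u *: ⟦x, w⟧.
Proof. by case/(_ u w) => _ []. Qed.

Lemma extremalE x : extremal br x <-> x <> 0 /\ ext x.
Proof.
split=> [Ex|[x0 ex]]; last by split=> //; exists (g x).
by split; [case: Ex | have [_ [_]] := gP; apply].
Qed.

Lemma extremal_ext x : extremal br x -> ext x.
Proof. by case/extremalE. Qed.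

Lemma ext0 : ext 0.
Proof. by move=> u w; rewrite !brE !g0l; split; [|split]; lmod k. Qed.

Lemma extZ a x : ext x -> ext (a *: x).
Proof.
move=> extx u w; rewrite !brE !gE; split; [|split].
- by rewrite ext1 //; lmod k.
- by rewrite ext2 //; lmod k.
- by rewrite ext3 //; lmod k.
Qed.

Lemma extN x : ext x -> ext (- x).
Proof. by rewrite -scaleN1r; apply: extZ. Qed.

(** A polynomial of degree at most two in [s] with the roots 0, 1 and [t] is zero, and [F b] is its
    leading coefficient. *)
Lemma quadratic_vanish (F : L -> L) a b t :
  (forall s, F (a + s *: b)
     = F a + s *: (F (a + b) - F a - F b) + s ^+ 2 *: F b) ->
  t != 0 -> t != 1 -> F a = 0 -> F (a + b) = 0 -> F (a + t *: b) = 0 -> F b = 0.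
Proof.
move=> /(_ t) + t0 t1 Fa Fab Ft; rewrite Fa Fab Ft => F0.
have: (t * (t - 1)) *: F b = 0 by rewrite F0; lmod k.
by move/eqP; rewrite scaler_eq0 mulf_eq0 subr_eq0 (negbTE t0) (negbTE t1) => /eqP.
Qed.

(* The extremal identities are quadratic, so three points of a line suffice. *)
Lemma ext_line t a b : t != 0 -> t != 1 ->
  ext a -> ext (a + b) -> ext (a + t *: b) -> ext b.
Proof.
move=> t0 t1 ea eab et u w; split; [|split]; apply/eqP; rewrite -subr_eq0; apply/eqP.
- pose F v := ⟦v, ⟦v, u⟧⟧ - (g v u *+ 2) *: v.
  apply: (@quadratic_vanish F a b t) => // [s|||]; rewrite /F.
  + by rewrite !brE !gE; lmod k.
  + by rewrite ext1 ?subrr.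
  + by rewrite ext1 ?subrr.
  + by rewrite ext1 ?subrr.
- pose F v := ⟦⟦v, u⟧, ⟦v, w⟧⟧
    - (g v ⟦u, w⟧ *: v + g v w *: ⟦v, u⟧ - g v u *: ⟦v, w⟧).
  apply: (@quadratic_vanish F a b t) => // [s|||]; rewrite /F.
  + by rewrite !brE !gE; lmod k.
  + by rewrite ext2 ?subrr.
  + by rewrite ext2 ?subrr.
  + by rewrite ext2 ?subrr.
- pose F v := ⟦v, ⟦u, ⟦v, w⟧⟧⟧
    - (g v ⟦u, w⟧ *: v - g v w *: ⟦v, u⟧ - g v u *: ⟦v, w⟧).
  apply: (@quadratic_vanish F a b t) => // [s|||]; rewrite /F.
  + by rewrite !brE !gE; lmod k.
  + by rewrite ext3 ?subrr.
  + by rewrite ext3 ?subrr.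
  + by rewrite ext3 ?subrr.
Qed.

(** * Exponentials, with [g z u *: z] in place of half of [⟦z, ⟦z, u⟧⟧] *)

Definition exp_ad z s u : L := u + s *: ⟦z, u⟧ + (s ^+ 2 * g z u) *: z.

Lemma exp_adD z s u v : exp_ad z s (u + v) = exp_ad z s u + exp_ad z s v.
Proof. by rewrite /exp_ad !brE !gE; lmod k. Qed.

Lemma exp_adZ z s a u : exp_ad z s (a *: u) = a *: exp_ad z s u.
Proof. by rewrite /exp_ad !brE !gE; lmod k. Qed.

(** The coefficients of [s] agree by the Jacobi identity, those of [s ^+ 2] by the second extremal
    identity, and the cubic terms cancel by the first. *)
Lemma exp_ad_br z s u w : ext z -> exp_ad z s ⟦u, w⟧ = ⟦exp_ad z s u, exp_ad z s w⟧.
Proof.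
move=> ez; rewrite /exp_ad !brE (brA z u w) (brC u z) (brC ⟦z, u⟧ z).
by rewrite (ext2 _ _ ez) !ext1 //; lmod k.
Qed.

(** * Consequences of simplicity; [lam] witnesses that the field is not F_2 *)

Variable lam : k.
Hypotheses (lam_neq0 : lam != 0) (lam_neq1 : lam != 1).
Hypothesis simpleL : simple_lie br.
Hypothesis genL : generated_by_pure_extremal br.

(** The multiples of [z] would form a nonzero ideal, hence all of [L], and the bracket would
    vanish. *)
Lemma line_not_ideal z : z <> 0 -> (forall w, exists c, ⟦z, w⟧ = c *: z) -> False.
Proof.
move=> z0 zw; have [[u [v uv0]] ideals] := simpleL.
case: (ideals (fun v => exists c, v = c *: z)).
- split; [by exists 0; rewrite scale0r|split; [|split]].
  + by move=> _ _ [a ->] [b ->]; exists (a + b); rewrite scalerDl.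
  + by move=> a _ [b ->]; exists (a * b); rewrite scalerA.
  + move=> w _ [b ->]; have [c Ec] := zw w; exists (- (b * c)).
    by rewrite brE brC Ec; lmod k.
- by move=> /(_ z) I0; apply/z0/I0; exists 1; rewrite scale1r.
- move=> IL; apply: uv0; have [[a ->] [b ->]] := (IL u, IL v).
  by rewrite !brE !scaler0.
Qed.

(** The second identity at [u = z] makes [f z *: ⟦z, v⟧] a multiple of [z], so [f z <> 0]
    contradicts [line_not_ideal]. The form [f] is arbitrary because [extremal_form_unique] needs
    this for a second form. *)
Lemma ext_form_self z f w :
  z <> 0 -> extremal_form br z f -> f z = 0 /\ f ⟦z, w⟧ = 0.
Proof.
move=> z0 fz; have e v : f z *: ⟦z, v⟧ = f ⟦z, v⟧ *: z.
  have [_ [+ _]] := fz z v; rewrite !brE scaler0 addr0 => /esym/eqP.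
  by rewrite subr_eq0 => /eqP.
have fz0 : f z = 0.
  apply/eqP/negPn/negP => nfz; apply: (line_not_ideal z0) => v.
  by exists ((f z)^-1 * f ⟦z, v⟧); rewrite -scalerA -e scalerA mulVf ?scale1r.
split=> //; have /esym/eqP := e w; rewrite fz0 scale0r scaler_eq0.
by case/orP => /eqP.
Qed.

Lemma ext_self z : ext z -> g z z = 0.
Proof.
move=> ez; have [->|/eqP z0] := eqVneq z 0; first exact: g0l.
by have [] := ext_form_self z z0 ez.
Qed.

Lemma ext_br_self z w : ext z -> g z ⟦z, w⟧ = 0.
Proof.
move=> ez; have [->|/eqP z0] := eqVneq z 0; first exact: g0l.
by have [] := ext_form_self w z0 ez.
Qed.

Lemma exp_adK z s u : ext z -> exp_ad z s (exp_ad z (- s) u) = u.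
Proof.
move=> ez; rewrite /exp_ad !brE !gE ext1 // ext_self // ext_br_self //.
by lmod k.
Qed.

Lemma exp_ad_inj z s : ext z -> injective (exp_ad z s).
Proof.
by move=> ez u v Euv; rewrite -(exp_adK (- s) u ez) -(exp_adK (- s) v ez) opprK Euv.
Qed.

Lemma exp_ad_extremal z s a : ext z -> extremal br a -> extremal br (exp_ad z s a).
Proof.
move=> ez /extremalE[a0 ea]; split.
  move=> Ea0; apply: a0; apply: (@exp_ad_inj z s ez); rewrite Ea0 /exp_ad.
  by rewrite !brE g0r; lmod k.
exists (fun u => g a (exp_ad z (- s) u)) => u w.
have [Eu Ew] := (exp_adK s u ez, exp_adK s w ez).
move: (exp_ad z (- s) u) (exp_ad z (- s) w) Eu Ew => u' w' <- <-.
rewrite -!exp_ad_br //.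
have K v : exp_ad z (- s) (exp_ad z s v) = v by rewrite -[in X in exp_ad z _ X](opprK s) exp_adK.
rewrite !K; split; [|split].
- by rewrite ext1 // exp_adZ.
- by rewrite ext2 // -scaleNr !exp_adD !exp_adZ scaleNr.
- by rewrite ext3 // -!scaleNr !exp_adD !exp_adZ !scaleNr.
Qed.

(** The span is closed under the bracket: for extremal [z] and [e], [⟦z, e⟧] is a combination of the
    extremal elements [exp_ad z 1 e], [e] and [z]. *)
Lemma span_extremal v : in_span (extremal br) v.
Proof.
have [S0 [SD SZ]] := in_span_submod (extremal br).
apply: genL => // [u w Su Sw|p [Ep _]]; last exact: in_span_gen.
have: submod (fun u => in_span (extremal br) ⟦u, w⟧).
  split; [|split]; first by rewrite br0l.
    by move=> a b Sa Sb; rewrite brDl; apply: SD.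
  by move=> a b Sb; rewrite brZl; apply: SZ.
move/in_span_sub; apply; last exact: Su.
move=> z Ez; have: submod (fun w => in_span (extremal br) ⟦z, w⟧).
  split; [|split]; first by rewrite br0r.
    by move=> a b Sa Sb; rewrite brDr; apply: SD.
  by move=> a b Sb; rewrite brZr; apply: SZ.
move/in_span_sub; apply; last exact: Sw.
move=> e Ee; have ez := extremal_ext Ez.
have -> : ⟦z, e⟧ = exp_ad z 1 e + (-1) *: e + (- g z e) *: z by rewrite /exp_ad; lmod k.
apply: (SD); first apply: (SD); last by apply/SZ/in_span_gen.
- by apply: in_span_gen; apply: (exp_ad_extremal 1 ez Ee).
- by apply/SZ/in_span_gen.
Qed.

Lemma extremal_submod (Q : L -> Prop) :
  submod Q -> (forall e, extremal br e -> Q e) -> forall v, Q v.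
Proof. by move=> QQ QE v; apply: in_span_sub QE (span_extremal v). Qed.

(* If two forms differ at [(z, w)], then [z], [w] and [⟦z, w⟧] span a nonzero
   ideal, and the characteristic is 2, so that [⟦z, w⟧] is central. *)
Lemma extremal_form_unique (g' : L -> L -> k) :
  is_extremal_bilinear_form br g' -> forall u w, g' u w = g u w.
Proof.
move=> [g'D [g'C g'E]]; pose d u w := g' u w - g u w.
have dDl c u v w : d (c *: u + v) w = c * d u w + d v w.
  by rewrite /d g'D !gE; ring.
have dC u v : d u v = d v u by rewrite /d g'C gC.
have dDr c u v w : d w (c *: u + v) = c * d w u + d w v by rewrite !(dC w).
suff d0 : forall u w, d u w = 0.
  by move=> u w; apply/eqP; rewrite -subr_eq0; apply/eqP/d0.
have subm z : submod (fun w => d z w = 0).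
  have dz0 : d z 0 = 0 by apply: (addrI (d z 0)); rewrite -{1}(mul1r (d z 0)) -dDr scaler0 !addr0.
  split; [|split] => // [u v du dv|a u du].
    by rewrite -(scale1r u) dDr du dv mulr0 addr0.
  by rewrite -(addr0 (_ *: _)) dDr du dz0 mulr0 addr0.
suff dE : forall z w, extremal br z -> extremal br w -> d z w = 0.
  move=> u; apply: extremal_submod => // w Ew; rewrite dC; move: u.
  by apply: extremal_submod => // z Ez; apply: dE.
move=> z w Ez Ew; apply/eqP/negPn/negP => dzw.
(* The identities of [e] for [g'] and for [g] have the same left-hand sides; [d2] and [dbr] compare
   the right-hand sides. *)
have d2 e u : extremal br e -> d e u *+ 2 = 0.
  move=> Ee; have [e0 ee] := (extremalE e).1 Ee; have [+ _] := g'E e Ee u 0.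
  rewrite ext1 // => /eqP; rewrite eq_sym -subr_eq0 -scalerBl -mulrnBl scaler_eq0.
  by case/orP => /eqP.
have dbr e u v : extremal br e ->
    d e ⟦u, v⟧ *: e + d e v *: ⟦e, u⟧ - d e u *: ⟦e, v⟧ = 0.
  move=> Ee; have ee := extremal_ext Ee.
  have [_ [+ _]] := g'E e Ee u v; rewrite ext2 // => /esym/eqP.
  by rewrite -subr_eq0 => /eqP <-; rewrite /d; lmod k.
have self e : extremal br e -> d e e = 0.
  move=> Ee; have [e0 ee] := (Ee.1, extremal_ext Ee); rewrite /d ext_self // subr0.
  by have [] := ext_form_self e e0 (g'E e Ee).
have dwz : d w z != 0 by rewrite dC.
have [dzz dww] := (self z Ez, self w Ew).
have kz u : d z u = 0 -> ⟦z, u⟧ = - (d z ⟦u, w⟧ / d z w) *: z.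
  move=> du; have := dbr z u w Ez; rewrite du scale0r subr0 => /eqP.
  rewrite addrC addr_eq0 => /eqP E.
  by rewrite -[LHS]scale1r -(mulVf dzw) -scalerA E; lmod k.
have kw u : d w u = 0 -> ⟦w, u⟧ = - (d w ⟦u, z⟧ / d w z) *: w.
  move=> du; have := dbr w u z Ew; rewrite du scale0r subr0 => /eqP.
  rewrite addrC addr_eq0 => /eqP E.
  by rewrite -[LHS]scale1r -(mulVf dwz) -scalerA E; lmod k.
have [[z0 ez] [w0 ew]] := ((extremalE z).1 Ez, (extremalE w).1 Ew).
set h := ⟦z, w⟧; pose T v := exists a b c, v = a *: z + b *: w + c *: h.
have TD u v : T u -> T v -> T (u + v).
  move=> [a [b [c ->]]] [a' [b' [c' ->]]]; exists (a + a'), (b + b'), (c + c').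
  by lmod k.
have TZ s u : T u -> T (s *: u).
  by move=> [a [b [c ->]]]; exists (s * a), (s * b), (s * c); lmod k.
have [Tz Tw] : T z /\ T w.
  by split; [exists 1, 0, 0 | exists 0, 1, 0]; lmod k.
have Th : T h by exists 0, 0, 1; lmod k.
have T0 : T 0 by exists 0, 0, 0; lmod k.
have TL v : T v.
  have [_ ideals] := simpleL; have [] := ideals T; last by apply.
    split=> //; split=> //; split=> // {}v _ [a [b [c ->]]].
    (* Chosen so that [d z u = d w u = 0]; by [kz] and [kw], [u] then acts diagonally on [z], [w]
       and [h]. *)
    pose u := v - (d z v / d z w) *: w - (d w v / d w z) *: z.
    have du e : d e u = d e v - (d z v / d z w) * d e w - (d w v / d w z) * d e z.
      rewrite -[u](_ : (- (d z v / d z w)) *: w + ((- (d w v / d w z)) *: z + v) = _) ?dDr.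
        by ring.
      by rewrite /u; lmod k.
    have [m Em] : exists m, ⟦z, u⟧ = m *: z.
      by eexists; apply: kz; rewrite du dzz divfK // mulr0 subr0 subrr.
    have [n En] : exists n, ⟦w, u⟧ = n *: w.
      by eexists; apply: kw; rewrite du dww divfK // mulr0 subr0 subrr.
    have -> : v = u + (d z v / d z w) *: w + (d w v / d w z) *: z by rewrite /u; lmod k.
    clearbody u; move: (d z v / d z w) (d w v / d w z) => p q.
    have E1 : ⟦u, z⟧ = - m *: z by rewrite brC Em; lmod k.
    have E2 : ⟦u, w⟧ = - n *: w by rewrite brC En; lmod k.
    have E3 : ⟦u, h⟧ = - (m + n) *: h by rewrite brA E1 E2 !brE -/h; lmod k.
    have E4 : ⟦z, h⟧ = (g z w *+ 2) *: z by rewrite ext1.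
    have E5 : ⟦w, h⟧ = - (g w z *+ 2) *: w by rewrite /h (brC z w) brE ext1 //; lmod k.
    rewrite !brE (brC w z) -/h E1 E2 E3 E4 E5.
    exists (- a * m + c * q * (g z w *+ 2)), (- b * n - c * p * (g w z *+ 2)),
      (b * q - a * p - c * (m + n)); lmod k.
  by move/(_ z Tz).
have two0 : 2%:R = 0 :> k.
  by apply: (mulfI dzw); rewrite mulr0 mulr_natr; apply: d2.
have zh : ⟦z, h⟧ = 0 by rewrite /h ext1 // -mulr_natr two0 mulr0 scale0r.
have wh : ⟦w, h⟧ = 0.
  by rewrite /h (brC z w) brNr ext1 // -mulr_natr two0 mulr0 scale0r oppr0.
have [h0|/eqP h0] := eqVneq h 0.
  apply: (line_not_ideal z0) => v; exists 0; have [a [b [c ->]]] := TL v.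
  by rewrite !brE -/h h0 brE; lmod k.
apply: (line_not_ideal h0) => v; exists 0; have [a [b [c ->]]] := TL v.
by rewrite !brE (brC h z) (brC h w) zh wh; lmod k.
Qed.

(** The pullback of [g] along the automorphism is again an extremal bilinear form, hence equals [g]
    by uniqueness. *)
Lemma g_exp_ad z s u w : ext z -> g (exp_ad z s u) (exp_ad z s w) = g u w.
Proof.
move=> ez; apply: (@extremal_form_unique (fun u w => g (exp_ad z s u) (exp_ad z s w))).
split; [|split] => [a {}u v {}w|{}u v|a Ea {}u {}w].
- by rewrite exp_adD exp_adZ !gE.
- exact: gC.
have ea := extremal_ext (exp_ad_extremal s ez Ea).
split; [|split]; apply: (@exp_ad_inj z s ez); rewrite -?scaleNr ?exp_adD ?exp_adZ !exp_ad_br //.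
- by rewrite ext1.
- by rewrite ext2 // scaleNr.
- by rewrite ext3 // !scaleNr.
Qed.

Lemma ext_exp_ad z s a : ext z -> ext a -> ext (exp_ad z s a).
Proof.
move=> ez ea; have [->|/eqP a0] := eqVneq a 0.
  suff -> : exp_ad z s 0 = 0 by apply: ext0.
  by rewrite /exp_ad !brE !gE; lmod k.
by apply/extremal_ext/exp_ad_extremal => //; apply/extremalE.
Qed.

(** Infinitesimal version of [g_exp_ad]: for extremal [z] invariance reads [s * A + s ^+ 2 * B = 0]
    for all [s], and the values 1 and [lam] force [A = 0]. *)
Lemma gA u v w : g ⟦u, v⟧ w = g u ⟦v, w⟧.
Proof.
suff skew z : ext z -> g ⟦z, u⟧ w + g u ⟦z, w⟧ = 0.
  move: v; apply: extremal_submod; last first.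
    move=> z /extremal_ext/skew/eqP; rewrite addr_eq0 => /eqP E.
    by rewrite (brC u z) gNl E opprK.
  split; [|split] => [|a b Ea Eb|a b Eb]; first by rewrite !brE !gE.
    by rewrite !brE !gE Ea Eb.
  by rewrite !brE !gE Eb.
move=> ez; pose A := g ⟦z, u⟧ w + g u ⟦z, w⟧.
pose B := g ⟦z, u⟧ ⟦z, w⟧ + g z u * g z w *+ 2.
have AB s : s * A + s ^+ 2 * B = 0.
  have := g_exp_ad s u w ez; rewrite /exp_ad !gE ext_self // ext_br_self //.
  rewrite (gC ⟦z, u⟧ z) ext_br_self // (gC u z) => E.
  by apply: (addrI (g u w)); rewrite addr0 -[in RHS]E /A /B; ring.
have A1 : A = - B by apply/eqP; rewrite -addr_eq0 -(AB 1); apply/eqP; ring.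
have : lam * (lam - 1) * B = 0 by rewrite -(AB lam) A1; ring.
move/eqP; rewrite !mulf_eq0 subr_eq0 (negbTE lam_neq0) (negbTE lam_neq1) /=.
by rewrite -/A A1 => /eqP->; rewrite oppr0.
Qed.

(** The radical of [g] is an ideal by [gA], and it is proper as [g] is nonzero. *)
Lemma g_nondegenerate v : (exists a b, g a b <> 0) ->
  (forall e, extremal br e -> g v e = 0) -> v = 0.
Proof.
move=> [a [b gab]] gv0; have subg u : submod (fun w => g u w = 0).
  split; [|split] => [|c d gc gd|c d gd]; rewrite gE //.
    by rewrite gc gd addr0.
  by rewrite gd mulr0.
have {}gv0 : forall w, g v w = 0 by apply: extremal_submod gv0.
have [_ ideals] := simpleL.
case: (ideals (fun u => forall w, g u w = 0)) => [|I0|IL]; first 1 last.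
- exact: I0.
- by case: gab; apply: IL.
split; [by move=> w; rewrite gE|split; [|split]] => [c d gc gd w|c d gd w|c d gd w].
- by rewrite gE gc gd addr0.
- by rewrite gE gd mulr0.
- by rewrite brC gE gA gd oppr0.
Qed.

(** * The 5-grading of a hyperbolic pair *)

Definition hyperbolic x y := ext x /\ ext y /\ g x y = 1.

Lemma hyperbolicC x y : hyperbolic x y -> hyperbolic y x.
Proof. by case=> ex [ey gxy]; split=> //; split=> //; rewrite gC. Qed.

(* [Lm x y] is L_{-1} (see [L_minus1E]) and [Lm y x] is L_1; unlike an eigenspace
   of [⟦x, y⟧], this characterization is valid in characteristic 2. *)
Definition Lm x y b := ⟦x, ⟦y, b⟧⟧ = - b.

(** Invariance of [g] and [g x y = 1] force the scalars at [x] and [y] to be opposite, hence a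
    single [m]. *)
Definition L0 x y n :=
  (exists m, ⟦x, n⟧ = - m *: x /\ ⟦y, n⟧ = m *: y) /\ g x n = 0 /\ g y n = 0.

(* The projection onto L_{-1}, see [decomposition]. *)
Definition pi x y v := - ⟦x, ⟦y, v⟧⟧ - (g y v *+ 2) *: x + g ⟦x, y⟧ v *: ⟦x, y⟧.

Lemma L0C x y n : L0 x y n -> L0 y x n.
Proof. by case=> -[m [Ex Ey]] [gx gy]; split=> //; exists (- m); rewrite opprK. Qed.

Lemma hyperbolic_xh x y : hyperbolic x y -> ⟦x, ⟦x, y⟧⟧ = 2%:R *: x.
Proof. by case=> ex [ey gxy]; rewrite ext1 // gxy. Qed.

Lemma hyperbolic_yh x y : hyperbolic x y -> ⟦y, ⟦x, y⟧⟧ = - 2%:R *: y.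
Proof.
by move=> H; rewrite (brC x y) brNr (hyperbolic_xh (hyperbolicC H)) scaleNr.
Qed.

Lemma g_xh x y : hyperbolic x y -> g x ⟦x, y⟧ = 0.
Proof. by case=> ex _; apply: ext_br_self. Qed.

Lemma g_yh x y : hyperbolic x y -> g y ⟦x, y⟧ = 0.
Proof. by case=> _ [ey _]; rewrite brC gE ext_br_self // oppr0. Qed.

Section Grading.
Variables (x y : L).
Hypothesis xy : hyperbolic x y.
Let extx : ext x := xy.1.
Let exty : ext y := xy.2.1.
Let gxy : g x y = 1 := xy.2.2.
Let gyx : g y x = 1 := etrans (gC y x) gxy.
Let xh := hyperbolic_xh xy.
Let yh := hyperbolic_yh xy.

(** If [⟦x, y⟧ = 0], the third identity at [y] gives [⟦x, w⟧ = g x ⟦w, y⟧ *: x] for all [w], so the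
    line of [x] is an ideal. *)
Lemma hyperbolic_br_neq0 : ⟦x, y⟧ <> 0.
Proof.
move=> h0; have x0 : x <> 0.
  by move=> x0; move/eqP: gxy; rewrite x0 gE eq_sym oner_eq0.
apply: (line_not_ideal x0) => w; exists (g x ⟦w, y⟧).
have := ext3 w y extx; rewrite h0 !brE gxy scaler0 subr0 scale1r => /esym/eqP.
by rewrite subr_eq0 => /eqP.
Qed.

Lemma Lm_gx b : Lm x y b -> g x b = 0.
Proof. by move=> Eb; rewrite -[b]opprK -Eb gE ext_br_self // oppr0. Qed.

(** Invariance shows that the value equals its own double, which makes it zero in every
    characteristic; [Lm_gy] is proved the same way. *)
Lemma Lm_gh b : Lm x y b -> g ⟦x, y⟧ b = 0.
Proof.
move=> Eb; suff E : g ⟦x, y⟧ b = g ⟦x, y⟧ b *+ 2.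
  by apply: (addIr (g ⟦x, y⟧ b)); rewrite add0r -mulr2n -E.
rewrite -{1}[b]opprK -Eb gE -gA (brC ⟦x, y⟧ x) xh !gE (gA x y b).
by ring.
Qed.

Lemma Lm_gy b : Lm x y b -> g y b = 0.
Proof.
move=> Eb; suff E : g y b = g y b *+ 2.
  by apply: (addIr (g y b)); rewrite add0r -mulr2n -E.
rewrite -{1}[b]opprK -Eb gE -gA (brC y x) gE opprK -gA (brC ⟦x, y⟧ y) yh !gE.
by ring.
Qed.

Lemma Lm_brx b : Lm x y b -> ⟦x, b⟧ = 0.
Proof.
move=> Eb; rewrite -[b]opprK -Eb brE ext1 // -gA Lm_gh //.
by rewrite mul0rn scale0r oppr0.
Qed.

Lemma Lm_swap b : Lm x y b -> Lm y x ⟦y, b⟧.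
Proof. by move=> Eb; rewrite /Lm Eb brE. Qed.

Lemma Lm_submod : submod (Lm x y).
Proof.
split; [|split] => [|a b Ea Eb|a b Eb]; rewrite /Lm ?brE ?oppr0 //.
  by rewrite Ea Eb; lmod k.
by rewrite Eb; lmod k.
Qed.

(** One direction is the third extremal identity; conversely [Lm] itself exhibits [v] as
    [⟦x, - ⟦y, v⟧⟧]. *)
Lemma L_minus1E v : L_minus1 br g x y v <-> Lm x y v.
Proof.
split=> [[u [[gux [guy guh]] ->]]|Ev].
  rewrite /Lm ext3 // -gA (gC _ u) guh (gC x) gux gxy; lmod k.
exists (- ⟦y, v⟧); split; last by rewrite brE Ev opprK.
split; [|split].
- by rewrite gE gC -gA Lm_gh // oppr0.
- by rewrite gE gC ext_br_self // oppr0.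
- by rewrite gE gC -gA (brC ⟦x, y⟧ y) yh !gE Lm_gy // !mulr0 !oppr0.
Qed.

(* The right-hand side expresses strong commutation of [x] and [b]. *)
Lemma Lm_br_ad b u : Lm x y b -> ⟦b, ⟦x, u⟧⟧ = g b u *: x + g x u *: b.
Proof.
move=> Eb; have {1}-> : b = ⟦x, - ⟦y, b⟧⟧ by rewrite brE Eb opprK.
rewrite ext2 // -gA brE Eb opprK !gE -gA Lm_gh //; lmod k.
Qed.

Lemma Lm_brLm b b' : Lm x y b -> Lm x y b' -> ⟦b, b'⟧ = g y ⟦b, b'⟧ *: x.
Proof.
move=> Eb Eb'; suff [c E] : exists c, ⟦b, b'⟧ = c *: x.
  by rewrite {1}E E gE gyx mulr1.
exists (g b (- ⟦y, b'⟧)); have {1}-> : b' = ⟦x, - ⟦y, b'⟧⟧ by rewrite brE Eb' opprK.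
have g0 : g x ⟦y, b'⟧ = 0 by rewrite -gA Lm_gh.
by rewrite Lm_br_ad // !gE g0; lmod k.
Qed.

Lemma L0_brh n : L0 x y n -> ⟦⟦x, y⟧, n⟧ = 0.
Proof.
case=> -[m [Ex Ey]] _; have := brA x y n; rewrite Ey Ex !brE (brC y x).
by move=> E; apply: (addIr (- m *: - ⟦x, y⟧)); rewrite -E; lmod k.
Qed.

Lemma L0_brLm n b : L0 x y n -> Lm x y b -> Lm x y ⟦n, b⟧.
Proof.
case=> -[m [Ex Ey]] _ Eb; rewrite /Lm (brA y n b) Ey !brE (brA x n ⟦y, b⟧) Ex.
by rewrite !brE Eb !brE; lmod k.
Qed.

Lemma piD u v : pi x y (u + v) = pi x y u + pi x y v.
Proof. by rewrite /pi !brE !gE; lmod k. Qed.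

Lemma piZ a u : pi x y (a *: u) = a *: pi x y u.
Proof. by rewrite /pi !brE !gE; lmod k. Qed.

Lemma pi0 : pi x y 0 = 0.
Proof. by rewrite -[in LHS](scale0r (0 : L)) piZ scale0r. Qed.

Lemma pi_Lm v : Lm x y (pi x y v).
Proof.
rewrite /Lm /pi !brE (ext3 x v exty) gyx yh -gA (brC y x) !brE xh !gE.
by lmod k.
Qed.

Lemma pi_id b : Lm x y b -> pi x y b = b.
Proof. by move=> Eb; rewrite /pi Eb Lm_gy // Lm_gh //; lmod k. Qed.

Lemma pi_xy : pi x y x = 0 /\ pi x y y = 0.
Proof.
rewrite /pi gyx (brC y x) !brE xh ext_self // (gC _ x) (gC _ y) g_xh // g_yh //.
by split; lmod k.
Qed.

Lemma pi_L0 n : L0 x y n -> pi x y n = 0.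
Proof.
case=> -[m [_ Ey]] [gxn gyn]; rewrite /pi Ey gA Ey gyn brE gE gxy; lmod k.
Qed.

End Grading.

Section GradedBrackets.
Variables (x y : L).
Hypothesis xy : hyperbolic x y.
Let yx : hyperbolic y x := hyperbolicC xy.

(** [⟦x, ⟦b, c⟧⟧ = ⟦b, ⟦x, c⟧⟧] is a bracket of two elements of L_{-1}, hence a multiple of [x];
    likewise for [y], and invariance matches the two scalars. *)
Lemma Lm_brL0 b c : Lm x y b -> Lm y x c -> L0 x y ⟦b, c⟧.
Proof.
move=> Eb Ec; have [bx cy] := (Lm_brx xy Eb, Lm_brx yx Ec); split; last first.
  by rewrite -gA bx (brC b c) gNr -gA cy !gE oppr0.
exists (- g b c); rewrite (brA x b c) (brA y b c) bx cy !brE add0r addr0 opprK.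
have Ey : ⟦⟦y, b⟧, c⟧ = g x ⟦⟦y, b⟧, c⟧ *: y by apply/(Lm_brLm yx)/Ec/Lm_swap.
have Ex : ⟦b, ⟦x, c⟧⟧ = g y ⟦b, ⟦x, c⟧⟧ *: x by apply/(Lm_brLm xy)/Lm_swap.
by rewrite Ey Ex -!gA (brC ⟦y, b⟧ x) Eb opprK gE.
Qed.

Lemma pi_Lm' c : Lm y x c -> pi x y c = 0.
Proof.
move=> Ec; rewrite /pi (Lm_brx yx Ec) (Lm_gx yx Ec).
have := Lm_gh yx Ec; rewrite (brC y x) gE => /eqP; rewrite oppr_eq0 => /eqP->.
by rewrite brE; lmod k.
Qed.

(** [n] is the remainder after the four explicit components; its brackets with [x] and [y] are
    computed by the third extremal identity. *)
Lemma decomposition v : exists2 n, L0 x y n &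
  v = g y v *: x + pi x y v + n + pi y x v + g x v *: y.
Proof.
exists (v - g y v *: x - pi x y v - pi y x v - g x v *: y); last by lmod k.
have [ex [ey gxy]] := xy; have gyx : g y x = 1 by rewrite gC.
have [E1 E2] := (pi_Lm xy v, pi_Lm yx v).
split; last first.
  move: (pi x y v) (pi y x v) E1 E2 => b c E1 E2.
  rewrite !gE gxy gyx !ext_self // (Lm_gx xy E1) (Lm_gy xy E1).
  by rewrite (Lm_gx yx E2) (Lm_gy yx E2); split; ring.
have brs p q : ⟦x, p⟧ = 0 -> ⟦y, q⟧ = 0 ->
    let n := v - g y v *: x - p - q - g x v *: y in
    ⟦x, n⟧ = ⟦x, v⟧ - ⟦x, q⟧ - g x v *: ⟦x, y⟧ /\
    ⟦y, n⟧ = ⟦y, v⟧ - g y v *: ⟦y, x⟧ - ⟦y, p⟧.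
  by move=> xp yq /=; rewrite !brE xp yq; split; lmod k.
exists (g ⟦x, y⟧ v); have [-> ->] := brs _ _ (Lm_brx xy E1) (Lm_brx yx E2).
rewrite /pi !brE (ext3 y v ex) (ext3 x v ey) gxy gyx.
rewrite (brC y x) !brE (hyperbolic_xh xy) (hyperbolic_yh xy) -!gA (brC y x) !gE.
by split; lmod k.
Qed.

End GradedBrackets.

Lemma ext_br y e : ext y -> ext e -> g y e = 0 -> ext ⟦y, e⟧.
Proof.
move=> ey ee gye; apply: (@ext_line lam e) => //.
  have -> : e + ⟦y, e⟧ = exp_ad y 1 e by rewrite /exp_ad gye; lmod k.
  exact: ext_exp_ad.
have -> : e + lam *: ⟦y, e⟧ = exp_ad y lam e by rewrite /exp_ad gye; lmod k.
exact: ext_exp_ad.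
Qed.

(* The composite of two exponentials is, up to scale, a torus element followed
   by the reflection swapping [x] and [y]; varying its parameter separates the
   graded components of [c + eta *: y]. *)
Lemma ext_reflect x y c eta : hyperbolic x y ->
  Lm y x c -> ext (c + eta *: y) -> ext ⟦x, c⟧.
Proof.
move=> H Ec ecy; have [extx [ey gxy]] := H; have gyx : g y x = 1 by rewrite gC.
have K := hyperbolicC H.
have E s : s != 0 -> exp_ad y s^-1 (exp_ad x s (c + eta *: y)) =
    s *: ⟦x, c⟧ + (s ^+ 2 * eta) *: x.
  move=> s0; rewrite /exp_ad !brE !gE (Lm_gy K Ec) gxy.
  rewrite (Lm_brx K Ec) Ec (hyperbolic_yh H) (Lm_gx K Ec) g_yh // ext_self // gyx.
  have -> : g y ⟦x, c⟧ = 0 by rewrite -gA (Lm_gh K Ec).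
  by rewrite (brC y x); lmod k; field.
have Es s : s != 0 -> ext (eta *: x + s *: ⟦x, c⟧).
  move=> s0; have := extZ (s ^+ 2) (ext_exp_ad s^-1^-1 ey (ext_exp_ad s^-1 extx ecy)).
  rewrite E ?invr_eq0 //.
  suff -> : s ^+ 2 *: (s^-1 *: ⟦x, c⟧ + (s^-1 ^+ 2 * eta) *: x) =
    eta *: x + s *: ⟦x, c⟧ by [].
  by lmod k; field.
apply: (@ext_line lam (eta *: x)) => //; first exact: extZ; last exact: Es.
by have := Es 1; rewrite scale1r oner_eq0; apply.
Qed.

(** By [ext_br], [⟦y, e⟧] is extremal, and it lies in L_1 + L_2; reflecting it gives minus the
    wanted component. *)
Lemma ext_pi x y e : hyperbolic x y -> ext e -> g y e = 0 -> ext (pi x y e).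
Proof.
move=> H ee gye; have [extx [ey gxy]] := H; have gyx : g y x = 1 by rewrite gC.
have := @ext_reflect x y (⟦y, e⟧ - g ⟦x, y⟧ e *: y) (g ⟦x, y⟧ e) H.
rewrite subrK /Lm !brE (ext3 x e ey) (hyperbolic_yh H) gye gyx -gA (brC y x) gE.
move=> /(_ _ (ext_br ey ee gye))/extN E; rewrite /pi gye.
set u := (X in ext X); suff -> : u = - (⟦x, ⟦y, e⟧⟧ - g ⟦x, y⟧ e *: ⟦x, y⟧).
  by apply: E; lmod k.
by rewrite /u; lmod k.
Qed.

(** Two reflections: the first drops the multiple of [x] and yields [⟦y, b⟧], the second yields
    [- b]. *)
Lemma ext_top x y b a : hyperbolic x y -> Lm x y b -> ext (b + a *: x) -> ext b.
Proof.
move=> H Eb eb; have e1 := ext_reflect (hyperbolicC H) Eb eb.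
have := @ext_reflect x y ⟦y, b⟧ 0 H (Lm_swap Eb); rewrite scale0r addr0 => /(_ e1).
by rewrite Eb -{2}[b]opprK => /extN.
Qed.

(** * Strongly commuting pairs *)

Lemma hyperbolic_exists p : ext p -> p <> 0 -> (exists a b, g a b <> 0) ->
  exists z, hyperbolic p z.
Proof.
move=> ep p0 gn0; have [e [Ee gpe]] : exists e, extremal br e /\ g p e <> 0.
  apply: NNPP => ne; apply: p0; apply: g_nondegenerate => // e Ee.
  by apply: NNPP => gpe; apply: ne; exists e.
exists ((g p e)^-1 *: e); split=> //; split; first exact/extZ/extremal_ext.
by rewrite gE mulVf //; apply/eqP.
Qed.

(** The last clause includes [b <> 0], at [t = 0]. *)
Definition strongly_commuting a b :=
  [/\ a <> 0, ext a, ext b, ⟦a, b⟧ = 0 &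
    (forall u, ⟦b, ⟦a, u⟧⟧ = g b u *: a + g a u *: b) /\ forall t, b <> t *: a].

Lemma Lm_strongly_commuting x y b :
  hyperbolic x y -> Lm x y b -> ext b -> b <> 0 -> strongly_commuting x b.
Proof.
move=> H Eb eb b0; have [extx [_ gxy]] := H; split => //; last split.
- by move=> x0; move/eqP: gxy; rewrite x0 gE eq_sym oner_eq0.
- exact: (Lm_brx H Eb).
- by move=> u; apply: (Lm_br_ad H).
- by move=> t bx; apply: b0; rewrite -(pi_id H Eb) bx piZ (pi_xy H).1 scaler0.
Qed.

(** Subtracting from [b] its component along [x] leaves an element of L_{-1}, extremal by
    [ext_top]. *)
Lemma strongly_commuting_Lm x y b : hyperbolic x y -> strongly_commuting x b ->
  exists c, [/\ Lm x y c, ext c & c <> 0].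
Proof.
move=> H [_ extx eb bx [bad nbx]]; have Ec : Lm x y (b - g b y *: x).
  rewrite /Lm brA (brC ⟦x, y⟧) !brE bx bad (hyperbolic_xh H).
  by have [_ [_ ->]] := H; rewrite !brE; lmod k.
exists (b - g b y *: x); split => //; last by move/eqP; rewrite subr_eq0 => /eqP/nbx.
by apply: (ext_top (a := g b y) H Ec); rewrite subrK.
Qed.

Lemma strongly_commutingZ s a b : s != 0 ->
  strongly_commuting (s *: a) b -> strongly_commuting a b.
Proof.
move=> s0; have : a = s^-1 *: (s *: a) by rewrite scalerA mulVf // scale1r.
move: (s *: a) => c -> [c0 ec eb cb [bad nbc]].
split=> //; [|exact: extZ| |split].
- by move/eqP; rewrite scaler_eq0 invr_eq0 (negbTE s0) => /eqP.
- by rewrite brE cb scaler0.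
- by move=> u; rewrite !brE bad gE; lmod k.
- by move=> t; rewrite scalerA => /nbc.
Qed.

Lemma strongly_commuting_exp_ad z s a b : ext z ->
  strongly_commuting a b -> strongly_commuting (exp_ad z s a) (exp_ad z s b).
Proof.
move=> ez [a0 ea eb ab [bad nba]]; have e0 : exp_ad z s 0 = 0 by rewrite /exp_ad !brE gE; lmod k.
split; [|exact: ext_exp_ad|exact: ext_exp_ad|by rewrite -exp_ad_br // ab|split].
- by move=> Ea; apply: a0; apply: (@exp_ad_inj z s ez); rewrite Ea e0.
- move=> u; rewrite -(exp_adK s u ez) -!exp_ad_br // !g_exp_ad // bad exp_adD !exp_adZ //.
- by move=> t; rewrite -exp_adZ => /(exp_ad_inj ez)/nba.
Qed.

(* The elements [a] with a strongly commuting partner span an ideal. *)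
Lemma strongly_commuting_transfer x y a b : hyperbolic x y ->
  strongly_commuting a b -> exists c, strongly_commuting x c.
Proof.
move=> H ab; have [extx [_ gxy]] := H; pose P a := exists b, strongly_commuting a b.
pose I := in_span P; have subI : submod I := in_span_submod P.
have [I0 [ID IZ]] := subI.
have exP z s c : ext z -> P c -> P (exp_ad z s c).
  by move=> ez [d cd]; exists (exp_ad z s d); apply: strongly_commuting_exp_ad.
have IL v : I v.
  have [_ ideals] := simpleL; have [] := ideals I; last by apply.
    split=> //; split=> //; split=> // {}v w Iw; move: v.
    apply: extremal_submod.
      split; [|split] => [|u v Iu Iv|c u Iu]; rewrite brE; [exact: I0|exact: ID|exact: IZ].
    move=> z /extremal_ext ez; apply: (@in_span_sub _ _ P (fun w => I ⟦z, w⟧) w _ _ Iw).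
      split; [|split] => [|u v Iu Iv|c u Iu]; rewrite brE; [exact: I0|exact: ID|exact: IZ].
    move=> c Pc; have exI s : I (exp_ad z s c - c).
      by apply: submodB => //; apply: in_span_gen => //; apply: exP.
    have l0 : lam * (lam - 1) != 0 by rewrite mulf_neq0 // subr_eq0.
    apply: (submod_unscale subI l0).
    (* This combination cancels the quadratic terms of the two exponentials. *)
    suff -> : (lam * (lam - 1)) *: ⟦z, c⟧ =
        lam ^+ 2 *: (exp_ad z 1 c - c) - (exp_ad z lam c - c).
      by apply: submodB => //; apply: IZ.
    by rewrite /exp_ad; lmod k.
  move/(_ a)=> a0; have [an0 _ _ _ _] := ab; case: an0; apply: a0.
  by apply: in_span_gen; exists b.
have [c [[d cd] gcx]] : exists c, P c /\ g c x <> 0.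
  apply: NNPP => nc; have : g y x = 0; last first.
    by move/eqP; rewrite gC gxy oner_eq0.
  apply: (@in_span_sub _ _ P (fun v => g v x = 0) y _ _ (IL y)).
    split; [|split] => [|u v gu gv|e u gu]; rewrite gE //.
      by rewrite gu gv addr0.
    by rewrite gu mulr0.
  by move=> c Pc; apply: NNPP => gcx; apply: nc; exists c.
have ec : ext c by case: cd.
have t0 : g c x != 0 by apply/eqP.
have [f] : P (exp_ad c (g c x)^-1 (exp_ad x 1 c)) by apply: (exP) => //; apply: (exP) => //; exists d.
(* This composite acts as a reflection carrying [c] to a multiple of [x]. *)
suff -> : exp_ad c (g c x)^-1 (exp_ad x 1 c) = g c x *: x.
  by move/(strongly_commutingZ t0); exists f.
rewrite /exp_ad !brE !gE (brC x c) !brE !gE ext1 // ext_self // ext_br_self // (gC x).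
by lmod k; field.
Qed.

(** * From collinear pairs to strongly commuting pairs *)

Lemma g_commuting p q : ext p -> p <> 0 -> ⟦p, q⟧ = 0 -> g p q = 0.
Proof.
(* If [g p q] were nonzero, the second extremal identity would make [p] central. *)
move=> ep p0 pq; apply/eqP/negPn/negP => gpq; apply: (line_not_ideal p0) => u.
exists 0; apply/eqP; rewrite scale0r -(inj_eq (scalerI gpq)) scaler0; apply/eqP.
have <- : - 0 *: p + g p q *: ⟦p, u⟧ - g p u *: 0 = g p q *: ⟦p, u⟧ by lmod k.
by have := ext2 u q ep; rewrite pq brE (brC u q) gE -gA pq gE.
Qed.

(** The defect in the identity required by [strongly_commuting p q]. *)
Definition comm_ad p q u := ⟦q, ⟦p, u⟧⟧ - g p u *: q - g q u *: p.

(* [1 + s *: comm_ad p q] is [exp(q) exp(s p) exp(- (s p + q))]. *)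
Lemma ext_comm_ad p q e : (forall s t, ext (s *: p + t *: q)) ->
  p <> 0 -> ⟦p, q⟧ = 0 -> ext e -> ext (comm_ad p q e).
Proof.
move=> epq p0 pq ee; have ep : ext p.
  by have := epq 1 0; rewrite scale1r scale0r addr0.
have eq : ext q by have := epq 0 1; rewrite scale1r scale0r add0r.
have gpq := g_commuting ep p0 pq; have qp : ⟦q, p⟧ = 0 by rewrite brC pq oppr0.
have gqp : g q p = 0 by rewrite gC.
have Fe s u : exp_ad q 1 (exp_ad p s u) = exp_ad (s *: p + q) 1 u + s *: comm_ad p q u.
  by rewrite /exp_ad /comm_ad !brE !gE qp gqp -gA qp g0l; lmod k.
have es s : ext (e + s *: comm_ad p q e).
  have er : ext (s *: p + q) by rewrite -[q]scale1r.
  have <- : exp_ad q 1 (exp_ad p s (exp_ad (s *: p + q) (- 1) e)) = e + s *: comm_ad p q e.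
    rewrite Fe exp_adK //; congr (_ + s *: _); rewrite /exp_ad /comm_ad !brE !gE.
    have qpq u : ⟦q, ⟦p, ⟦q, u⟧⟧⟧ = 0.
      by rewrite (brA p) pq br0l add0r ext1 // -gA qp g0l mul0rn scale0r.
    have gpqu u : g p ⟦q, u⟧ = 0 by rewrite -gA pq g0l.
    have gqpu u : g q ⟦p, u⟧ = 0 by rewrite -gA qp g0l.
    rewrite pq qpq gpqu gqpu gpq gqp !ext1 // !ext_self // !ext_br_self // !brE qp.
    by lmod k.
  by do !apply: ext_exp_ad.
(* All points [e + s *: comm_ad p q e] are extremal, hence so is the direction of the line. *)
apply: (@ext_line lam e) => //.
by rewrite -[comm_ad p q e]scale1r.
Qed.

(* In characteristic 2 a point [q] collinear with [p] in the sense of [collinear]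
   may lie in L_0 instead of L_{-1}, so that [comm_ad p q] is nonzero. Its values at
   extremal elements then provide extremal elements of L_{-1}. *)
Section CommutingLine.
Variables (p q z : L).
Hypothesis pz : hyperbolic p z.
Hypothesis epq : forall s t, ext (s *: p + t *: q).
Hypotheses (pq : ⟦p, q⟧ = 0) (zq : ⟦z, q⟧ = 0).
Hypotheses (gpq : g p q = 0) (gzq : g z q = 0).

Let b e := ⟦q, ⟦p, pi z p e⟧⟧.

Lemma commuting_line_L0 : L0 p z q.
Proof. by split=> //; exists 0; rewrite pq zq oppr0 !scale0r. Qed.

Lemma commuting_line_Lm e : Lm p z (b e).
Proof.
by apply: (L0_brLm commuting_line_L0); apply: (Lm_swap (pi_Lm (hyperbolicC pz) e)).
Qed.

(** As [q] commutes with [p], [z] and hence [⟦p, z⟧], only the component of [e] in L_1 contributes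
    to [⟦q, ⟦p, e⟧⟧]. *)
Lemma commuting_line_comm_ad e : comm_ad p q e = b e - g p e *: q - g q e *: p.
Proof.
rewrite /comm_ad; congr (_ - _ - _).
have [n [[m [pn _]] _] Ee] := decomposition pz e.
have qh : ⟦q, ⟦p, z⟧⟧ = 0 by rewrite brC (L0_brh commuting_line_L0) oppr0.
have qp : ⟦q, p⟧ = 0 by rewrite brC pq oppr0.
have pb : ⟦p, pi p z e⟧ = 0 := Lm_brx pz (pi_Lm pz e).
rewrite {1}Ee /b; move: (pi p z e) (pi z p e) pb => c d pc.
by rewrite !brE pc pn !brE qh qp; lmod k.
Qed.

Lemma commuting_line_ext e : ext e -> ext (b e).
Proof.
have [ep [ez gpz]] := pz; have p0 : p <> 0.
  by move=> p0; move/eqP: gpz; rewrite p0 gE eq_sym oner_eq0.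
move=> ee; have eD := ext_comm_ad epq p0 pq ee.
have Eb := commuting_line_Lm e; rewrite commuting_line_comm_ad in eD.
have [gqe|gqe] := eqVneq (g q e) 0.
  have := ext_pi pz eD; rewrite gqe !gE gzq (Lm_gy pz Eb) => H.
  have {H} := H ltac:(ring); rewrite scale0r subr0 -scaleNr piD piZ.
  by rewrite (pi_id pz Eb) (pi_L0 pz commuting_line_L0) scaler0 addr0.
(* With [p'] in place of [p], the extremal element becomes [b e - g q e *: p'], to which [ext_top]
   applies for the pair [p'], [z]. *)
pose p' := p + (g p e / g q e) *: q.
have p'z : hyperbolic p' z.
  split; [|split] => //; first by have := epq 1 (g p e / g q e); rewrite scale1r.
  by rewrite /p' !gE (gC q z) gzq mulr0 addr0.
have qbz : ⟦q, ⟦z, b e⟧⟧ = 0.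
  rewrite brA (brC q z) zq oppr0 br0l add0r /b ext1; last first.
    by have := epq 0 1; rewrite scale1r scale0r add0r.
  have qp : ⟦q, p⟧ = 0 by rewrite brC pq oppr0.
  by rewrite -gA qp g0l mul0rn scale0r br0r.
apply: (ext_top (a := - g q e) p'z); first by rewrite /Lm /p' !brE Eb qbz; lmod k.
suff -> : b e + - g q e *: p' = b e - g p e *: q - g q e *: p by [].
by rewrite /p'; lmod k; field.
Qed.

(* Otherwise [q] would lie in the ideal of the elements of L_0 killing all other
   graded components. *)
Lemma commuting_line_b_neq0 : q <> 0 -> exists e, extremal br e /\ b e <> 0.
Proof.
move=> q0; apply: NNPP => nb; have b0 : forall e, b e = 0.
  apply: extremal_submod.
    split; [|split] => [|u v|c u]; rewrite /b.
    - by rewrite pi0 !br0r.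
    - by rewrite piD !brE => -> ->; rewrite addr0.
    - by rewrite piZ !brE => ->; rewrite scaler0.
  by move=> e Ee; apply: NNPP => be; apply: nb; exists e.
have zp := hyperbolicC pz.
have qc c : Lm z p c -> ⟦q, ⟦p, c⟧⟧ = 0.
  by move=> Ec; have := b0 c; rewrite /b (pi_id zp Ec).
have qLm c : Lm p z c -> ⟦q, c⟧ = 0.
  by move=> Ec; rewrite -[c]opprK -Ec brE (qc _ (Lm_swap Ec)) oppr0.
have qLp c : Lm z p c -> ⟦q, c⟧ = 0.
  move=> Ec; rewrite -[c]opprK -Ec brE brA qc // br0r addr0.
  by rewrite (brC q z) zq oppr0 br0l oppr0.
pose Z n := ((⟦n, p⟧ = 0 /\ ⟦n, z⟧ = 0) /\
   (forall c, Lm p z c -> ⟦n, c⟧ = 0) /\ (forall c, Lm z p c -> ⟦n, c⟧ = 0)).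
have [_ ideals] := simpleL; case: (ideals Z).
- split; [|split; [|split]].
  + by split; [split; rewrite br0l|split=> c _; rewrite br0l].
  + move=> u v [[u1 u2] [u3 u4]] [[v1 v2] [v3 v4]]; split; [|split].
    * by rewrite !brE u1 u2 v1 v2 addr0.
    * by move=> c Ec; rewrite brE u3 // v3 // addr0.
    * by move=> c Ec; rewrite brE u4 // v4 // addr0.
  + move=> a u [[u1 u2] [u3 u4]]; split; [|split].
    * by rewrite !brE u1 u2 scaler0.
    * by move=> c Ec; rewrite brE u3 // scaler0.
    * by move=> c Ec; rewrite brE u4 // scaler0.
  + move=> v n [[n1 n2] [n3 n4]]; have [w Lw Ev] := decomposition pz v.
    have Evn : ⟦v, n⟧ = - ⟦n, w⟧.
      rewrite brC Ev; have := (n3 _ (pi_Lm pz v), n4 _ (pi_Lm zp v)).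
      by move: (pi p z v) (pi z p v) => c d [nc nd]; rewrite !brE n1 n2 nc nd; lmod k.
    have [[m [pw zw]] _] := Lw.
    have brnw c : ⟦n, c⟧ = 0 -> ⟦n, ⟦w, c⟧⟧ = 0 -> ⟦⟦v, n⟧, c⟧ = 0.
      move=> nc nwc; have := brA n w c; rewrite nc nwc br0r addr0 Evn brE => <-.
      by rewrite oppr0.
    split; [split|split].
    * by apply: brnw => //; rewrite (brC w p) pw !brE n1 scaler0 oppr0.
    * by apply: brnw => //; rewrite (brC w z) zw !brE n2 scaler0 oppr0.
    * by move=> c Ec; apply: brnw; [apply: n3|apply/n3/(L0_brLm Lw)].
    * by move=> c Ec; apply: brnw; [apply: n4|apply/n4/(L0_brLm (L0C Lw))].
- move/(_ q) => Zq; apply: q0; apply: Zq.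
  by split; [split; rewrite brC ?pq ?zq oppr0|split].
- move/(_ p) => [[_ pz0] _]; exact: (hyperbolic_br_neq0 pz).
Qed.

End CommutingLine.

(** Once the component of [q] along [p] is removed, a nonzero component in L_{-1} is a partner of
    [p]; if that component vanishes, the partner is a value of [b] above. *)
Lemma strongly_commuting_exists p q : (exists a b, g a b <> 0) ->
  collinear br p q -> exists a b, strongly_commuting a b.
Proof.
move=> gn0 [[Ep _] [[Eq _] [dpq [pq epq]]]].
have [[p0 ep] [q0 eq]] := ((extremalE p).1 Ep, (extremalE q).1 Eq).
have {}epq s t : ext (s *: p + t *: q).
  by case: (epq s t) => [/extremal_ext//|->]; apply: ext0.
have [z pz] := hyperbolic_exists ep p0 gn0; have [_ [ez gpz]] := pz.
have gzp : g z p = 1 by rewrite gC.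
pose q1 := q - g z q *: p.
have q1_neq0 : q1 <> 0.
  move/eqP; rewrite subr_eq0 => /eqP Eqp; apply: dpq => v.
  have c0 : g z q != 0 by apply/eqP => c0; apply: q0; rewrite Eqp c0 scale0r.
  split=> -[c ->].
    by exists (c / g z q); rewrite [X in _ = _ *: X]Eqp scalerA divfK.
  by exists (c * g z q); rewrite [X in _ *: X = _]Eqp scalerA.
have epq1 s t : ext (s *: p + t *: q1).
  by have := epq (s - t * g z q) t; congr (ext _); rewrite /q1; lmod k.
have pq1 : ⟦p, q1⟧ = 0 by rewrite /q1 !brE pq; lmod k.
have gzq1 : g z q1 = 0 by rewrite /q1 !gE gzp; ring.
have eq1 : ext q1 by have := epq1 0 1; rewrite scale1r scale0r add0r.
have gpq1 := g_commuting ep p0 pq1.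
clearbody q1.
have [b0|/eqP b0] := eqVneq (pi p z q1) 0; last first.
  exists p, (pi p z q1); apply: (Lm_strongly_commuting pz) => //.
    exact: (pi_Lm pz).
  exact: (ext_pi pz).
(* The component in L_1 vanishes because [q1] commutes with [p], so [q1] lies in L_0, with scalar
   [m = 0]. *)
have zq1 : ⟦z, q1⟧ = 0.
  have [n [[m [pn zn]] _] Eq1] := decomposition pz q1.
  have c0 : pi z p q1 = 0.
    by rewrite /pi pq1 gpq1 gA pq1 !gE brE; lmod k.
  have Eqn : q1 = n by rewrite Eq1 b0 c0 gzq1 gpq1; lmod k.
  have m0 : m = 0.
    move/eqP: pn; rewrite -Eqn pq1 eq_sym scaler_eq0 oppr_eq0.
    by case/orP => /eqP.
  by rewrite Eqn zn m0 scale0r.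
have [e [/extremal_ext ee be]] := commuting_line_b_neq0 pz pq1 zq1 q1_neq0.
exists p; eexists; apply: (Lm_strongly_commuting pz) be.
  exact: (commuting_line_Lm pz).
exact: (commuting_line_ext pz).
Qed.

(** * Noncommuting extremal elements in L_{-1} *)

Lemma Lm_br_pi x y b e : hyperbolic x y -> Lm x y b ->
  ⟦b, pi x y e⟧ = - g ⟦b, y⟧ e *: x.
Proof.
move=> H Eb; have bx : ⟦b, x⟧ = 0 by rewrite brC (Lm_brx H Eb) oppr0.
rewrite /pi !brE bx !(Lm_br_ad H) // (gC b y) (Lm_gy H Eb) H.2.2 !gA; lmod k.
Qed.

(** Nondegeneracy provides [e] with [g ⟦b, y⟧ e <> 0]; an exponential of [b] makes it orthogonal to
    [y] without changing this value, and its component in L_{-1} serves as [c]. *)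
Lemma Lm_noncommuting x y b : hyperbolic x y -> Lm x y b -> ext b -> b <> 0 ->
  exists c, [/\ Lm x y c, ext c & g y ⟦b, c⟧ != 0].
Proof.
move=> H Eb eb b0; have [_ [_ gxy]] := H; have gyx : g y x = 1 by rewrite gC.
have [e [ee gbe]] : exists e, ext e /\ g ⟦b, y⟧ e != 0.
  apply: NNPP => ne; apply: b0.
  suff by0 : ⟦b, y⟧ = 0 by rewrite -[b]opprK -Eb (brC y b) by0 oppr0 br0r oppr0.
  apply: g_nondegenerate => [|f /extremal_ext ef].
    by exists x, y; rewrite gxy; apply/eqP/oner_neq0.
  by apply: NNPP => gf; apply: ne; exists f; split=> //; apply/eqP.
have ybe : g ⟦y, b⟧ e = - g ⟦b, y⟧ e by rewrite brC gE.
pose t := g y e / g ⟦b, y⟧ e; have ef : ext (exp_ad b t e) by apply: ext_exp_ad.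
have gyf : g y (exp_ad b t e) = 0.
  by rewrite /exp_ad !gE -gA ybe (Lm_gy H Eb) /t; field.
exists (pi x y (exp_ad b t e)); split; [exact: pi_Lm|exact: ext_pi|].
rewrite (Lm_br_pi _ H Eb) gE gyx mulr1 oppr_eq0.
suff -> : g ⟦b, y⟧ (exp_ad b t e) = g ⟦b, y⟧ e by [].
rewrite /exp_ad !gE -(gA _ b e) (brC ⟦b, y⟧ b) ext1 // (gC b y) (Lm_gy H Eb).
by rewrite (gC ⟦b, y⟧ b) ext_br_self // !gE; ring.
Qed.

(** * Components in L_{-1} modulo a submodule [Q] containing its extremal elements *)

Section ModuloSpan.
Variables (x y : L).
Hypothesis xy : hyperbolic x y.
Let yx : hyperbolic y x := hyperbolicC xy.
Variable Q : L -> Prop.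
Hypotheses (subQ : submod Q) (QE : forall v, Lm x y v -> ext v -> Q v).
Let gyx : g y x = 1 := yx.2.2.

(** Bracketing with [c] raises degrees by one, so only the component of [v] along [x] reaches
    L_{-1}. *)
Lemma pi_brLp c v : Lm y x c -> pi x y ⟦c, v⟧ = g y v *: ⟦c, x⟧.
Proof.
move=> Ec; have [n Ln {1}->] := decomposition xy v.
move: (g y v) (g x v) (pi x y v) (pi y x v) (pi_Lm xy v) (pi_Lm yx v).
move=> al de p r Ep Er.
have cy : ⟦c, y⟧ = 0 by rewrite brC (Lm_brx yx Ec) oppr0.
have cn : pi x y ⟦c, n⟧ = 0.
  by rewrite brC -scaleN1r piZ (pi_Lm' xy) ?scaler0 //; apply/L0_brLm/Ec/L0C.
have cp : pi x y ⟦c, p⟧ = 0.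
  by rewrite brC -scaleN1r piZ (pi_L0 xy) ?scaler0 //; apply: Lm_brL0.
rewrite !brDr !brZr (Lm_brLm yx Ec Er) cy !piD !piZ cn cp (pi_xy xy).2 pi0.
rewrite (@pi_id _ _ xy ⟦c, x⟧); first by lmod k.
by rewrite brC; have [_ [_ SZ]] := Lm_submod x y; rewrite -scaleN1r; apply/SZ/Lm_swap.
Qed.

Lemma Lm_brLp c : Lm y x c -> Lm x y ⟦c, x⟧.
Proof.
move=> Ec; have [_ [_ SZ]] := Lm_submod x y.
by rewrite brC -scaleN1r; apply/SZ/Lm_swap.
Qed.

(** The operator preserves degrees, so it commutes with the projection. *)
Lemma pi_brLm_brLp b c v : Lm x y b -> Lm y x c ->
  pi x y ⟦b, ⟦c, v⟧⟧ = ⟦b, ⟦c, pi x y v⟧⟧.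
Proof.
move=> Eb Ec; have [n Ln {1}->] := decomposition xy v.
move: (g y v) (g x v) (pi x y v) (pi y x v) (pi_Lm xy v) (pi_Lm yx v).
move=> al de p r Ep Er.
have cy : ⟦c, y⟧ = 0 by rewrite brC (Lm_brx yx Ec) oppr0.
have cn : pi x y ⟦b, ⟦c, n⟧⟧ = 0.
  rewrite (brC c) brNr -scaleN1r piZ (pi_L0 xy) ?scaler0 //.
  by apply: Lm_brL0 => //; apply/L0_brLm/Ec/L0C.
have cp : pi x y ⟦b, ⟦c, p⟧⟧ = ⟦b, ⟦c, p⟧⟧.
  apply: pi_id => //; have [_ [_ SZ]] := Lm_submod x y.
  rewrite (brC b) (brC c) brNl opprK; apply: L0_brLm Eb; exact: Lm_brL0.
have cx : pi x y ⟦b, ⟦c, x⟧⟧ = 0.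
  by rewrite (Lm_brLm xy Eb (Lm_brLp Ec)) piZ (pi_xy xy).1 scaler0.
have by0 : pi x y ⟦b, y⟧ = 0.
  by rewrite brC -scaleN1r piZ (pi_Lm' xy) ?scaler0 //; apply: Lm_swap.
rewrite !brDr !brZr (Lm_brLm yx Ec Er) cy brZr br0r !piD !piZ cn cp cx by0 pi0.
by lmod k.
Qed.

Lemma gy_brLm_brLp b c v : Lm x y b -> Lm y x c ->
  g y ⟦b, ⟦c, v⟧⟧ = g y ⟦b, ⟦c, x⟧⟧ * g y v.
Proof.
move=> Eb Ec; rewrite -!gA (Lm_brLm yx (Lm_swap Eb) Ec) !gE gyx; ring.
Qed.

Lemma ext_brLp c : Lm y x c -> ext c -> ext ⟦x, c⟧.
Proof.
by move=> Ec ec; apply: (ext_reflect (eta := 0) xy Ec); rewrite scale0r addr0.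
Qed.

(* Reads off the component in L_{-1} of [exp_ad b t (exp_ad c s e)], with [t]
   chosen to make its component along [x] vanish. *)
Lemma span_exp_ad b c e s : Lm x y b -> Lm y x c -> ext b -> ext c -> ext e ->
  let sg := g y ⟦b, e⟧ + s * (g y ⟦b, ⟦c, x⟧⟧ * g y e) in
  sg != 0 ->
  Q (sg *: pi x y e - g y e *: pi x y ⟦b, e⟧
     - (s * g y e) *: ⟦b, ⟦c, pi x y e⟧⟧).
Proof.
move=> Eb Ec eb ec ee sg sg0; have [Q0 [QD QZ]] := subQ.
pose f := exp_ad c s e; pose t := - g y e / sg.
have ef : ext f by apply: ext_exp_ad.
have gyc : g y c = 0 := Lm_gx yx Ec.
have gyb : g y b = 0 := Lm_gy xy Eb.
have yc : ⟦y, c⟧ = 0 := Lm_brx yx Ec.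
have gybc : g y ⟦b, c⟧ = 0 by rewrite (brC b) gE -gA yc gE oppr0.
have gybf : g y ⟦b, f⟧ = sg.
  by rewrite /f /exp_ad !brE !gE gybc gy_brLm_brLp //; rewrite /sg; ring.
have gyf : g y f = g y e.
  by rewrite /f /exp_ad !gE -gA yc gyc gE; ring.
have pic : pi x y c = 0 := pi_Lm' xy Ec.
have pibc : pi x y ⟦b, c⟧ = 0 by apply/(pi_L0 xy)/Lm_brL0.
have pif : pi x y f = pi x y e + (s * g y e) *: ⟦c, x⟧.
  by rewrite /f /exp_ad !piD !piZ pic pi_brLp // scaler0 addr0 scalerA.
have pibf : pi x y ⟦b, f⟧ = pi x y ⟦b, e⟧ + s *: ⟦b, ⟦c, pi x y e⟧⟧.
  have -> : ⟦b, f⟧ = ⟦b, e⟧ + s *: ⟦b, ⟦c, e⟧⟧ + (s ^+ 2 * g c e) *: ⟦b, c⟧.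
    by rewrite /f /exp_ad !brE.
  by rewrite !piD !piZ pibc pi_brLm_brLp // scaler0 addr0.
clearbody f; pose f' := exp_ad b t f.
have ef' : ext f' by apply: ext_exp_ad.
have gyf' : g y f' = 0.
  by rewrite /f' /exp_ad !gE gyf gybf gyb /t; field.
have pif' : pi x y f' = pi x y f + t *: pi x y ⟦b, f⟧ + (t ^+ 2 * g b f) *: b.
  by rewrite {1}/f' /exp_ad !piD !piZ (pi_id xy Eb).
have Qf' : Q (pi x y f') by apply: QE; [exact: pi_Lm|exact: ext_pi].
have Qcx : Q ⟦c, x⟧.
  by apply: QE; [exact: Lm_brLp|rewrite brC; apply/extN/ext_brLp].
have Qb : Q b by apply: QE.
suff -> : sg *: pi x y e - g y e *: pi x y ⟦b, e⟧ - (s * g y e) *: ⟦b, ⟦c, pi x y e⟧⟧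
   = sg *: (pi x y f') + (- (sg * s * g y e)) *: ⟦c, x⟧
     + (- (sg * (t ^+ 2 * g b f))) *: b.
  by apply: (QD); [apply: (QD)|]; apply: (QZ).
rewrite pif' pibf pif; move: (g b f) => gbf.
by lmod k; rewrite /t; field.
Qed.

Lemma span_ad_scalar b c e : Lm x y b -> Lm y x c -> ext b -> ext c -> ext e ->
  g y ⟦b, ⟦c, x⟧⟧ != 0 -> g y e != 0 ->
  Q (g y ⟦b, ⟦c, x⟧⟧ *: pi x y e - ⟦b, ⟦c, pi x y e⟧⟧).
Proof.
move=> Eb Ec eb ec ee ka0 ge0; have Qs s := @span_exp_ad b c e s Eb Ec eb ec ee.
have [Q0 [QD QZ]] := subQ.
pose K := g y ⟦b, ⟦c, x⟧⟧ * g y e; pose be := g y ⟦b, e⟧.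
have K0 : K != 0 by rewrite mulf_neq0.
(* [be + s * K] is affine in [s] with nonzero slope, so at most one of 0, 1, [lam] is a root. *)
have [s [s' [ss' [n n']]]] : exists s s',
    s != s' /\ be + s * K != 0 /\ be + s' * K != 0.
  have [be0|be0] := eqVneq be 0.
    exists 1, lam; rewrite be0 !add0r mul1r; split; first by rewrite eq_sym.
    by split=> //; apply: mulf_neq0.
  have [bK|bK] := eqVneq (be + K) 0; last first.
    by exists 0, 1; rewrite mul0r mul1r addr0 eq_sym oner_neq0.
  exists 0, lam; rewrite mul0r addr0 eq_sym lam_neq0; split=> //; split=> //.
  have -> : be = - K by apply/eqP; rewrite -addr_eq0 bK.
  have -> : - K + lam * K = (lam - 1) * K by ring.
  by rewrite mulf_neq0 // subr_eq0.
(* The terms independent of [s] cancel, leaving [(s - s') * g y e] times the claim. *)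
have QQ := submodB subQ (Qs s n) (Qs s' n').
have c0 : (s - s') * g y e != 0 by rewrite mulf_neq0 // subr_eq0.
apply: (submod_unscale subQ c0).
by apply: (@eq_ind _ _ Q QQ); rewrite /K; lmod k.
Qed.

Lemma pi_in_span b c e : Lm x y b -> Lm y x c -> ext b -> ext c -> ext e ->
  g y ⟦b, ⟦c, x⟧⟧ != 0 -> Q (pi x y e).
Proof.
move=> Eb Ec eb ec ee ka0.
have [ge0|ge0] := eqVneq (g y e) 0.
  by apply: QE; [exact: pi_Lm|exact: ext_pi].
(* The second pair is [⟦x, c⟧], [⟦y, b⟧]; by [d'x] and [db] it has the same scalar as the pair [b],
   [c]. *)
have Ed := Lm_swap Ec; have Ed' := Lm_swap Eb.
have ed : ext ⟦x, c⟧ := ext_brLp Ec ec.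
have ed' : ext ⟦y, b⟧ := ext_br yx.1 eb (Lm_gy xy Eb).
have xb : ⟦x, b⟧ = 0 := Lm_brx xy Eb.
have d'x : ⟦⟦y, b⟧, x⟧ = b by rewrite brC Eb opprK.
have bcx := Lm_brLm xy Eb (Lm_brLp Ec).
have db : ⟦⟦x, c⟧, b⟧ = ⟦b, ⟦c, x⟧⟧ by rewrite brC (brC x c) brNr opprK.
have ka0' : g y ⟦⟦x, c⟧, ⟦⟦y, b⟧, x⟧⟧ != 0 by rewrite d'x db.
have := span_ad_scalar Ed Ed' ed ed' ee ka0' ge0; rewrite d'x db.
have := span_ad_scalar Eb Ec eb ec ee ka0 ge0.
move: (g y ⟦b, ⟦c, x⟧⟧) (pi x y e) (pi_Lm xy e) bcx ka0 => ka a Ea bcx ka0 Q1 Q2.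
have [Q0 [QD QZ]] := subQ.
have [tau ba] : exists tau, ⟦b, a⟧ = tau *: x.
  by exists (g y ⟦b, a⟧); apply: (Lm_brLm xy).
have [om cya] : exists om, ⟦c, ⟦y, a⟧⟧ = om *: y.
  by exists (g x ⟦c, ⟦y, a⟧⟧); apply: (Lm_brLm yx) => //; apply: Lm_swap.
have [[m [xz _]] _] := Lm_brL0 xy Ea Ed'.
have Ez : ⟦⟦y, b⟧, a⟧ = tau *: ⟦y, x⟧ - ⟦b, ⟦y, a⟧⟧.
  by have := brA y b a; rewrite ba brE => ->; lmod k.
have cyx : ⟦c, ⟦y, x⟧⟧ = c.
  by rewrite (Lm_br_ad yx x Ec) (gC c x) (Lm_gy yx Ec) gyx; lmod k.
have xcb : ⟦x, ⟦c, b⟧⟧ = ka *: x by rewrite brA xb br0r addr0 db.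
have cba : ⟦⟦c, b⟧, a⟧ = tau *: ⟦c, x⟧ - ⟦b, ⟦c, a⟧⟧.
  by have := brA c b a; rewrite ba brE => ->; lmod k.
have xby : ⟦x, ⟦b, y⟧⟧ = b by rewrite (brC b y) brNr Eb opprK.
have xcbya : ⟦x, ⟦c, ⟦b, ⟦y, a⟧⟧⟧⟧ =
    - ka *: a - tau *: ⟦c, x⟧ + ⟦b, ⟦c, a⟧⟧ + om *: b.
  rewrite (brA c b) cya !brDr !brZr xby (brA x ⟦c, b⟧) xcb brZl Ea brNr cba.
  by lmod k.
have xz' : ⟦x, ⟦⟦y, b⟧, a⟧⟧ = m *: x by rewrite (brC _ a) brNr xz; lmod k.
(* The two operators add up to [ka] on [a], up to multiples of [⟦c, x⟧] and [b], which lie in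
   [Q]. *)
have dd' : ⟦⟦x, c⟧, ⟦⟦y, b⟧, a⟧⟧ = ka *: a - ⟦b, ⟦c, a⟧⟧ - m *: ⟦c, x⟧ - om *: b.
  have := brA x c ⟦⟦y, b⟧, a⟧; rewrite xz' {1}Ez !brDr !brNr !brZr cyx xcbya.
  move/eqP; rewrite -subr_eq => /eqP <-.
  by rewrite (brC x c); lmod k.
apply: (submod_unscale subQ ka0).
have Qcx : Q ⟦c, x⟧.
  by apply: QE; [exact: Lm_brLp|rewrite brC; apply/extN].
have -> : ka *: a = (ka *: a - ⟦⟦x, c⟧, ⟦⟦y, b⟧, a⟧⟧) + (ka *: a - ⟦b, ⟦c, a⟧⟧)
    + (- m) *: ⟦c, x⟧ + (- om) *: b.
  by rewrite dd'; lmod k.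
apply: (QD); last by apply/QZ/QE.
apply: (QD); last exact: QZ.
exact: QD.
Qed.

End ModuloSpan.

(** * The spanning statement for L_{-1} and its transfer to L_1 *)

Lemma L_minus1_spanned x y : geometry_has_lines br -> hyperbolic x y ->
  forall v, L_minus1 br g x y v <->
    in_span (fun e => extremal br e /\ L_minus1 br g x y e) v.
Proof.
move=> [p [q pq]] xy v; rewrite (L_minus1E xy).
have gn0 : exists a b, g a b <> 0.
  by exists x, y; rewrite xy.2.2; apply/eqP/oner_neq0.
set P := (X in in_span X); split=> [Ev|]; last first.
  by apply: in_span_sub; [exact: Lm_submod|move=> e [_ /(L_minus1E xy)]].
have [a [b ab]] := strongly_commuting_exists gn0 pq.
have [c0 xc0] := strongly_commuting_transfer xy ab.
have [d [Ed ed d0]] := strongly_commuting_Lm xy xc0.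
have [f [Ef ef df]] := Lm_noncommuting xy Ed ed d0.
have subP := in_span_submod P.
(* Writing [v] as [pi x y v] gives a linear claim about all of [L], to be checked on extremal
   elements only. *)
rewrite -(pi_id xy Ev); move: v {Ev}; apply: extremal_submod.
  have [P0 [PD PZ]] := subP.
  split; [|split] => [|u v Pu Pv|c u Pu].
  - by rewrite pi0.
  - by rewrite piD; apply: PD.
  - by rewrite piZ; apply: PZ.
move=> e /extremal_ext ee.
apply: (@pi_in_span x y xy (in_span P) subP _ d ⟦y, f⟧) => //.
- move=> u Eu eu; have [->|/eqP u0] := eqVneq u 0; first by case: subP.
  by apply: in_span_gen; split; [apply/extremalE|apply/L_minus1E].
- exact: Lm_swap.
- exact: ext_br xy.2.1 ef (Lm_gy xy Ef).
(* For [c = ⟦y, f⟧] one has [⟦c, x⟧ = f], so the required scalar is [g y ⟦d, f⟧], nonzero by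
   [df]. *)
- by rewrite (brC _ x) Ef opprK.
Qed.

End ExtremalLie.

Theorem theorem3p8 (k : fieldType) (L : lmodType k) (br : L -> L -> L)
  (g : L -> L -> k) (x y : L) :
  is_lie_bracket br ->
  (exists a : k, a <> 0 /\ a <> 1) ->
  simple_lie br ->
  generated_by_pure_extremal br ->
  geometry_has_lines br ->
  is_extremal_bilinear_form br g ->
  extremal br x -> extremal br y -> g x y = 1 ->
  (forall v : L, L_minus1 br g x y v <->
     in_span (fun e => extremal br e /\ L_minus1 br g x y e) v) /\
  (forall v : L, L_plus1 br g x y v <->
     in_span (fun e => extremal br e /\ L_plus1 br g x y e) v).
Proof.
move=> brP [lam [/eqP lam0 /eqP lam1]] simpleL genL lines gP Ex Ey gxy.
have [extx exty] := (extremal_ext gP Ex, extremal_ext gP Ey).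
have xy : hyperbolic br g x y by [].
have yx := hyperbolicC gP xy.
have spanned := L_minus1_spanned brP gP lam0 lam1 simpleL genL lines.
split; first exact: spanned xy.
(* L_1 of the pair [x], [y] is L_{-1} of the pair [y], [x], since swapping only changes the sign of
   [⟦x, y⟧]. *)
have plusE v : L_plus1 br g x y v <-> L_minus1 br g y x v.
  suff UE u : grading_U br g x y u <-> grading_U br g y x u.
    by split=> -[u [/UE Uu ->]]; exists u.
  have guE : g u (br y x) = - g u (br x y) by rewrite (brC brP) (gNr gP).
  rewrite /grading_U guE; split=> -[-> [-> E]]; split=> //; split=> //.
    by rewrite E oppr0.
  by apply: oppr_inj; rewrite oppr0.
move=> v; rewrite plusE; rewrite (spanned _ _ yx).
split; apply: in_span_sub; try exact: in_span_submod.
  by move=> e [Ee /plusE Ue]; apply: in_span_gen.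
by move=> e [Ee /plusE Ue]; apply: in_span_gen.
Qed.
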